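(* The semigroup $\{e^{t\mathbf A^\infty_\Phi}\}_{t\ge0}$ on $\mathbf C(I)$ generated by $\mathbf A^\infty_\Phi$ is positive if and only if both of the following hold: (i) all off-diagonal entries of the matrices $-\mathbb K^{00}$ and $\mathbb K^{11}$ are nonnegative; (ii) all entries of the matrices $-\mathbb K^{01}$ and $\mathbb K^{10}$ are nonnegative.
   Context: Let $I=[0,1]$ and $m\in\mathbb N$. $\mathbf C(I)$ and $\mathbf C^2(I)$ denote the $m$-fold products of $C(I)$ and $C^2(I)$, i.e. spaces of vector functions $\mathbf u=(u_1,\dots,u_m)$. Let $\mathbb D=\mathrm{diag}\{\sigma_i\}_{1\le i\le m}$ with constants $\sigma_i>0$, and let $\mathbb K^{00},\mathbb K^{01},\mathbb K^{10},\mathbb K^{11}$ be arbitrary real $m\times m$ matrices. The operator $\mathbf A^\infty_\Phi$ in $\mathbf C(I)$ is $\mathbf u\mapsto\mathbb D\,\partial_{xx}\mathbf u$ on the domain of all $\mathbf u\in\mathbf C^2(I)$ satisfying $$\partial_x\mathbf u(0)=\mathbb K^{00}\mathbf u(0)+\mathbb K^{01}\mathbf u(1),\qquad \partial_x\mathbf u(1)=\mathbb K^{10}\mathbf u(0)+\mathbb K^{11}\mathbf u(1).$$ It generates an analytic semigroup on $\mathbf C(I)$, denoted $\{e^{t\mathbf A^\infty_\Phi}\}_{t\ge0}$. A semigroup is positive if each of its operators maps vector functions with nonnegative components to vector functions with nonnegative components. *)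

(* Defs.v *)
From HB Require Import structures.
From mathcomp Require Import all_boot all_order all_algebra.
From mathcomp Require Import all_classical all_reals all_analysis.

Set Implicit Arguments.
Unset Strict Implicit.
Unset Printing Implicit Defensive.

Import Order.TTheory GRing.Theory Num.Theory.
Import numFieldNormedType.Exports.

Local Open Scope classical_set_scope.
Local Open Scope ring_scope.

Section UnitInterval.
Variable R : realType.

Definition unitI : Type := set_type (`[0, 1]%classic : set R).

HB.instance Definition _ := PseudoMetric.on unitI.

Lemma mem_unitI0 : (0 : R) \in (`[0, 1]%classic : set R).
Proof. by apply/mem_set; rewrite /= in_itv /= lexx ler01. Qed.

Lemma mem_unitI1 : (1 : R) \in (`[0, 1]%classic : set R).
Proof. by apply/mem_set; rewrite /= in_itv /= lexx ler01. Qed.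

Definition I0 : unitI := exist _ 0 mem_unitI0.
Definition I1 : unitI := exist _ 1 mem_unitI1.

Definition pt (x : unitI) : R := set_val x.

End UnitInterval.

Arguments I0 {R}.
Arguments I1 {R}.

Section ContinuousVectorFunctions.
Variables (R : realType) (m : nat).

(* A fresh type, because continuousType already carries the topology of
   pointwise convergence. *)
Record CI := MkCI {
  CI_fun :> unitI R -> 'cV[R]_m ;
  CI_cts : `[< continuous CI_fun >] }.

Definition CI_pred : {pred unitI R -> 'cV[R]_m} := fun f => `[< continuous f >].

HB.instance Definition _ := [isSub of CI for CI_fun].
HB.instance Definition _ := [Choice of CI by <:].

Lemma CI_continuous (u : CI) : continuous u.
Proof. exact/asboolP/CI_cts. Qed.

Lemma CI_submod_closed : submod_closed CI_pred.
Proof.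
split; first by apply/asboolP; rewrite -[0]/(cst 0); exact: cst_continuous.
move=> a f g /asboolP cf /asboolP cg; apply/asboolP => x.
refine (cvgD (cvgZr (k := a) (cf x)) (cg x)).
Qed.

HB.instance Definition _ := GRing.SubChoice_isSubLmodule.Build R
  (unitI R -> 'cV[R]_m) CI_pred CI CI_submod_closed.

Lemma CI_bounded (u : CI) : has_ubound (range (fun x => `|u x|)).
Proof.
have uE : sigL `[0, 1]%classic ('valL_0 u) = u by exact: valLK.
have : compact (range u).
  have /continuous_compact/(_ (@segment_compact R 0 1)) :
      {within `[0, 1]%classic, continuous ('valL_0 u)}.
    exact/subspace_valL_continuousP'/CI_continuous.
  congr compact; apply/seteqP; split => [_ [x /mem_set xI <-]|_ [x _ <-]].
    by exists (exist _ x xI) => //; rewrite -[CI_fun u in LHS]uE.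
  by exists (set_val x); [exact: set_valP|rewrite -[CI_fun u in RHS]uE].
move=> /compact_bounded[M [_ Mu]]; exists (M + 1) => _ [x _ <-].
by apply: (Mu (M + 1)); [rewrite ltrDl|exists x].
Qed.

Definition sup_norm (u : CI) : R := sup (range (fun x => `|u x|)).

Lemma le_sup_norm (u : CI) x : `|u x| <= sup_norm u.
Proof. by apply: ub_le_sup; [exact: CI_bounded|exists x]. Qed.

Lemma sup_norm_le (u : CI) M : (forall x, `|u x| <= M) -> sup_norm u <= M.
Proof.
by move=> uM; apply: ge_sup; [exists `|u I0|, I0|move=> _ [x _ <-]].
Qed.

Lemma sup_normD (u v : CI) : sup_norm (u + v) <= sup_norm u + sup_norm v.
Proof.
apply: sup_norm_le => x.
by rewrite (le_trans (ler_normD _ _))// lerD// le_sup_norm.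
Qed.

Lemma sup_normZ (l : R) (u : CI) : sup_norm (l *: u) = `|l| * sup_norm u.
Proof.
have leZ k (v : CI) : sup_norm (k *: v) <= `|k| * sup_norm v.
  by apply: sup_norm_le => x; rewrite normrZ ler_wpM2l// le_sup_norm.
apply/eqP; rewrite eq_le leZ /=.
have [->|l0] := eqVneq l 0.
  by rewrite normr0 mul0r (le_trans (normr_ge0 _) (le_sup_norm _ I0)).
rewrite -ler_pdivlMl ?normr_gt0// -normfV.
by rewrite -{1}[u]scale1r -(mulVf l0) -scalerA leZ.
Qed.

Lemma sup_norm0_eq0 (u : CI) : sup_norm u = 0 -> u = 0.
Proof.
move=> u0; apply/val_inj/funext => x.
by apply/eqP; rewrite -normr_le0 -u0 le_sup_norm.
Qed.

HB.instance Definition _ :=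
  Lmodule_isNormed.Build R CI sup_normD sup_normZ sup_norm0_eq0.

End ContinuousVectorFunctions.

Section Semigroups.
Variables (R : realType) (V : normedModType R).

(* Only the values T t with 0 <= t are constrained. *)
Definition C0_semigroup (T : R -> V -> V) : Prop :=
  [/\ forall t, 0 <= t -> linear (T t) /\ continuous (T t),
      forall u, T 0 u = u,
      forall s t u, 0 <= s -> 0 <= t -> T (s + t) u = T s (T t u)
    & forall u, T t u @[t --> 0^'+] --> u].

(* Unbounded operators are represented by their graphs. *)
Definition generator (T : R -> V -> V) : V -> V -> Prop :=
  fun u f => h^-1 *: (T h u - u) @[h --> 0^'+] --> f.

Definition generates (A : V -> V -> Prop) (T : R -> V -> V) : Prop :=
  C0_semigroup T /\ forall u f, A u f <-> generator T u f.

End Semigroups.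

Section DiffusionOperator.
Variables (R : realType) (m : nat).

(* One-sided at the endpoints, since y ranges over unitI. *)
Definition is_deriv (u v : CI R m) : Prop :=
  forall x : unitI R,
    (pt y - pt x)^-1 *: (u y - u x) @[y --> x^'] --> v x.

(* u is C^2 because its derivatives v and w are elements of CI. *)
Definition A_Phi (sigma : 'rV[R]_m) (K00 K01 K10 K11 : 'M[R]_m)
    (u f : CI R m) : Prop :=
  exists v w : CI R m,
    [/\ is_deriv u v /\ is_deriv v w,
        v I0 = K00 *m u I0 + K01 *m u I1,
        v I1 = K10 *m u I0 + K11 *m u I1
      & forall x, f x = diag_mx sigma *m w x].

Definition nonneg_fun (u : CI R m) : Prop := forall x i, 0 <= u x i 0.

Definition positive_semigroup (T : R -> CI R m -> CI R m) : Prop :=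
  forall t, 0 <= t -> forall u, nonneg_fun u -> nonneg_fun (T t u).

End DiffusionOperator.

(* Main.v *)
Require Import Defs.
From HB Require Import structures.
From mathcomp Require Import all_boot all_order all_algebra.
From mathcomp Require Import all_classical all_reals all_analysis.
From mathcomp Require Import ring lra.

(** Both directions come down to the sign of the generator at a point where a
    component of a vector function is minimal.

    Necessity.  Let the semigroup be positive, let u be a nonnegative element
    of the domain and let its component i vanish at x.  The difference
    quotients of the orbit of u are then nonnegative at (x, i), and so is their
    limit A u ([generator_positive_minimum]).  If a sign condition fails in
    row i of K00 or K01, then there are boundary values a = u(0) and b = u(1),
    with a_i = 0 and all other entries positive, for which the boundary
    condition forces u_i'(0) > 0 ([row_nonpositive]).  A polynomial with these
    data can leave 0 with this slope, stay nonnegative and yet be so concave at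
    0 that A u is negative there ([left_test_function]): contradiction.  The
    rows of K10 and K11 are treated in the same way at the other endpoint.

    Sufficiency.  This is a maximum principle for the implicit Euler scheme.
    A barrier is a scalar function phi >= 1, so steep at both ends that phi
    times the vector of ones violates the boundary conditions strictly.  Take
    u in the domain and the least q for which u >= - q phi.  If q > 0, some
    component u_i touches - q phi; under the sign conditions it cannot do so at
    an endpoint, and at an interior point the second derivative test gives
    A u >= - q mu for a constant mu ([range_A_lower_bound]).  Hence
    u - h A u >= - c phi implies u >= - c / (1 - h mu) phi
    ([resolvent_lower_bound]).  The orbit of u in the domain obeys the Euler
    scheme with time step h up to the error T(kh) (T(h) u - u - h T(h) A u),
    which is o(h) uniformly in k because the operators of the semigroup are
    uniformly bounded for short times ([C0_semigroup_locally_bounded], by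
    the uniform boundedness principle in the complete space C(I)).  Adding up
    n = t / h steps and letting h tend to 0 bounds T(t) u below by - 2 c phi
    when u >= - c phi ([orbit_lower_bound]).  The domain is dense, since a
    Bernstein polynomial can be made to satisfy the boundary conditions by a
    correction that is uniformly small ([domain_dense]); applied to elements
    of the domain close to a nonnegative u, where c is small, the bound gives
    T(t) u >= 0 for small t, and the semigroup law extends this to all t. *)

Set Implicit Arguments.
Unset Strict Implicit.
Unset Printing Implicit Defensive.

Import Order.TTheory GRing.Theory Num.Theory.
Import numFieldNormedType.Exports.

Local Open Scope classical_set_scope.
Local Open Scope ring_scope.

(** * The unit interval *)

Section UnitIntervalTopology.
Variable R : realType.

Lemma pt_ge0 (x : unitI R) : 0 <= pt x.
Proof. by have := set_valP x; rewrite /= in_itv /= => /andP[]. Qed.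

Lemma pt_le1 (x : unitI R) : pt x <= 1.
Proof. by have := set_valP x; rewrite /= in_itv /= => /andP[]. Qed.

Lemma pt_inj : injective (@pt R).
Proof. exact: val_inj. Qed.

Lemma ptI (t : R) : 0 <= t <= 1 -> exists x : unitI R, pt x = t.
Proof.
move=> t01; suff tI : t \in `[0, 1]%classic by exists (exist _ t tI).
by apply/mem_set; rewrite /= in_itv.
Qed.

Lemma pt_continuous : continuous (@pt R).
Proof. exact: initial_continuous. Qed.

Lemma nbhs_unitIP (x : unitI R) (P : set (unitI R)) :
  nbhs x P <-> exists2 d : R, 0 < d & forall y, `|pt y - pt x| < d -> P y.
Proof.
split=> [/nbhs_ballP[d /= d0 dP]|[d d0 dP]].
  exists d => // y yd; apply: dP; change (`|pt x - pt y| < d).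
  by rewrite distrC.
apply/nbhs_ballP; exists d => //= y; change (`|pt x - pt y| < d -> P y).
by rewrite distrC; exact: dP.
Qed.

(** The retraction of the line onto the interval; composing with it turns
    functions on the interval into functions on the line, to which the
    one-variable calculus of real functions applies. *)
Definition clampI (t : R) : unitI R.
Proof.
refine (exist _ (Num.max 0 (Num.min 1 t)) _).
by apply/mem_set; rewrite /= in_itv /= le_max lexx /= ge_max ler01 ge_min lexx.
Defined.

Lemma pt_clampI (t : R) : 0 <= t <= 1 -> pt (clampI t) = t.
Proof.
move=> /andP[t0 t1].
by rewrite (_ : pt _ = Num.max 0 (Num.min 1 t))// min_r// max_r.
Qed.

Lemma clampIK (x : unitI R) : clampI (pt x) = x.
Proof. by apply: pt_inj; rewrite pt_clampI// pt_ge0 pt_le1. Qed.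

Lemma clampI_continuous : continuous clampI.
Proof.
move=> t A /nbhs_unitIP[d d0 dA].
apply/nbhs_ballP; exists d => //= s ts; apply: dA.
apply: le_lt_trans ts.
rewrite (_ : pt (clampI t) = Num.max 0 (Num.min 1 t))//.
rewrite (_ : pt (clampI s) = Num.max 0 (Num.min 1 s))//.
rewrite /Num.max /Num.min.
have st := ler_norm (s - t); have ts := ler_norm (t - s).
rewrite distrC in st; move: (`|t - s|) st ts => d' st ts; rewrite ler_norml.
by case: (ltP 1 t) => ?; case: (ltP 1 s) => ?;
  do ?case: ifPn; rewrite -?leNgt => *; lra.
Qed.

Lemma EVT_min_unitI (g : unitI R -> R) : continuous g ->
  exists x, forall y, g x <= g y.
Proof.
move=> cg; have [|c _ cmin] := @EVT_min R (g \o clampI) 0 1 ler01.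
  apply: continuous_subspaceT => t.
  by apply: continuous_comp; [exact: clampI_continuous|exact: cg].
exists (clampI c) => y; rewrite -[y]clampIK; apply: cmin.
by rewrite in_itv /= pt_ge0 pt_le1.
Qed.

End UnitIntervalTopology.

(** * Continuous vector functions, componentwise *)

Section VectorFunctions.
Variables (R : realType) (m : nat).
Implicit Types (u v w : CI R m).

Lemma coord_le_norm_cV (a : 'cV[R]_m) i : `|a i 0| <= `|a|.
Proof.
rewrite [leRHS]mx_normrE.
exact: (le_bigmax _ (fun ij : 'I_m * 'I_1 => `|a ij.1 ij.2|) (i, 0)).
Qed.

Lemma norm_cV_le (a : 'cV[R]_m) c :
  0 <= c -> (forall i, `|a i 0| <= c) -> `|a| <= c.
Proof.
move=> c0 ac; rewrite [leLHS]mx_normrE; apply: bigmax_le => // -[i j] _ /=.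
by rewrite ord1.
Qed.

Lemma cvg_cV (T : Type) (F : set_system T) {FF : Filter F}
    (f : T -> 'cV[R]_m) (l : 'cV[R]_m) :
  (forall i, f x i 0 @[x --> F] --> l i 0) -> f x @[x --> F] --> l.
Proof.
move=> fl; apply/cvgrPdist_le => e e0.
have H i : \forall x \near F, `|l i 0 - f x i 0| <= e.
  by have /cvgrPdist_le := fl i; apply.
have := filter_forall FF H; apply: filterS => x xe.
by apply: norm_cV_le; [exact: ltW|move=> i; rewrite !mxE; exact: xe].
Qed.

Lemma cvg_coord (T : Type) (F : set_system T) {FF : Filter F}
    (f : T -> 'cV[R]_m) (l : 'cV[R]_m) i :
  f x @[x --> F] --> l -> f x i 0 @[x --> F] --> l i 0.
Proof.
move=> fl.
exact: (cvg_comp f (fun a : 'cV[R]_m => a i 0) fl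
  (@coord_continuous R m 1 i 0 l)).
Qed.

Lemma coord_le_norm u x i : `|u x i 0| <= `|u|.
Proof. exact: le_trans (coord_le_norm_cV _ _) (le_sup_norm u x). Qed.

Lemma CI_norm_le u c :
  0 <= c -> (forall x i, `|u x i 0| <= c) -> `|u| <= c.
Proof.
move=> c0 uc; apply: sup_norm_le => x; exact: norm_cV_le.
Qed.

Lemma CI_coord_continuous u i : continuous (fun x => u x i 0).
Proof. by move=> x; exact: (cvg_coord (i := i) (@CI_continuous R m u x)). Qed.

Lemma is_deriv_coord u v : is_deriv u v -> forall x i,
  (pt y - pt x)^-1 * (u y i 0 - u x i 0) @[y --> x^'] --> v x i 0.
Proof.
move=> uv x i; rewrite [X in X @ _](_ : _ = fun y =>
  ((pt y - pt x)^-1 *: (u y - u x)) i 0); last by apply/funext=> y; rewrite !mxE.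
exact: cvg_coord (uv x).
Qed.

Lemma CI_MVT u v i (x y : unitI R) : is_deriv u v -> pt x < pt y ->
  exists2 z, pt x < pt z < pt y &
    u y i 0 - u x i 0 = v z i 0 * (pt y - pt x).
Proof.
move=> uv xy.
pose f t := u (clampI t) i 0; pose df t := v (clampI t) i 0.
have cf : continuous f.
  move=> t; apply: (@continuous_comp _ _ _ (@clampI R) (fun x => u x i 0)).
    exact: clampI_continuous.
  exact: CI_coord_continuous.
have dfP t : t \in `]pt x, pt y[ -> is_derive t 1 f (df t).
  rewrite in_itv/= => /andP[xt ty].
  have t0 : 0 < t by exact: le_lt_trans (pt_ge0 x) xt.
  have t1 : t < 1 by exact: lt_le_trans ty (pt_le1 y).
  have xI : pt (clampI t) = t by rewrite pt_clampI// !ltW.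
  suff L : h^-1 *: ((f \o shift t) (h *: 1) - f t) @[h --> 0^'] --> df t.
    by apply: DeriveDef; [apply/cvg_ex; exists (df t)|exact: cvg_lim L].
  have /cvgrPdist_le uvt := is_deriv_coord (x := clampI t) (i := i) uv.
  apply/cvgrPdist_le => e /uvt /nbhs_unitIP[d d0 dP].
  near=> h.
  have h01 : 0 <= t + h <= 1.
    have : `|h| < t by near: h; apply: dnbhs0_lt.
    have : `|h| < 1 - t by near: h; apply: dnbhs0_lt; rewrite subr_gt0.
    by rewrite !ltr_norml; lra.
  have ptth : pt (clampI (t + h)) = t + h by exact: pt_clampI.
  have h0 : h != 0 by near: h; exact: nbhs_dnbhs_neq.
  have := dP (clampI (t + h)); rewrite ptth xI addrAC subrr add0r.
  rewrite /f /= /shift /= [h *: 1]mulr1 [h + t]addrC; apply.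
    by near: h; apply: dnbhs0_lt.
  apply/eqP => /(congr1 (@pt R)); rewrite ptth xI => /eqP.
  by rewrite -subr_eq0 addrAC subrr add0r (negbTE h0).
have [|c] := @MVT R f df (pt x) (pt y) xy dfP.
  exact: continuous_subspaceT.
rewrite in_itv/= => /andP[xc cy].
rewrite /f /df !clampIK => E; exists (clampI c) => //.
rewrite pt_clampI ?xc// (le_trans (pt_ge0 x) (ltW xc)).
by rewrite (le_trans (ltW cy) (pt_le1 y)).
Unshelve. all: by end_near. Qed.
End VectorFunctions.

(** * Polynomial vector functions *)

Section Polynomials.
Variables (R : realType) (m : nat).
Implicit Types (p q : 'I_m -> {poly R}) (u v : CI R m).

Lemma is_derivD u v (u' v' : CI R m) :
  is_deriv u u' -> is_deriv v v' -> is_deriv (u + v) (u' + v').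
Proof.
move=> du dv x; rewrite [X in X @ _](_ : _ = fun y =>
    (pt y - pt x)^-1 *: (u y - u x) + (pt y - pt x)^-1 *: (v y - v x)).
  exact: (@cvgD _ _ _ (x^') _ _ _ _ _ (du x) (dv x)).
by apply/funext => y; rewrite -scalerDr opprD addrACA.
Qed.

Lemma poly_fun_continuous p :
  continuous (fun x : unitI R => \col_i (p i).[pt x]).
Proof.
move=> x; apply: (cvg_cV (F := nbhs x)) => i; rewrite mxE.
rewrite [X in X @ _](_ : _ = horner (p i) \o @pt R).
  by apply: continuous_comp; [exact: pt_continuous|exact: continuous_horner].
by apply/funext => y /=; rewrite mxE.
Qed.

Definition polyCI p : CI R m := MkCI (asboolT (@poly_fun_continuous p)).

Lemma polyCIE p x i : polyCI p x i 0 = (p i).[pt x].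
Proof. by rewrite mxE. Qed.

Lemma is_deriv_polyCI p : is_deriv (polyCI p) (polyCI (fun i => (p i)^`())).
Proof.
move=> x; apply: (cvg_cV (F := x^')) => i; rewrite polyCIE.
have [dp E] := is_derive_poly (p i) (pt x).
have L : h^-1 *: ((horner (p i) \o shift (pt x)) (h *: 1) - (p i).[pt x])
    @[h --> 0^'] --> (p i)^`().[pt x] by rewrite -E; exact: dp.
have K : (pt y - pt x) @[y --> x^'] --> 0^'.
  move=> A /nbhs_ballP[d /= d0 dA]; apply/nbhs_unitIP; exists d => // y yd yx.
  apply: dA; first by rewrite /ball/= sub0r normrN.
  by rewrite subr_eq0; apply/eqP => /pt_inj yE; rewrite yE eqxx in yx.
rewrite [X in X @ _](_ : _ = (fun h : R =>
    h^-1 *: ((horner (p i) \o shift (pt x)) (h *: 1) - (p i).[pt x])) \o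
  (fun y => pt y - pt x)); first exact: cvg_comp K L.
apply/funext => y; rewrite /= !mxE [(pt y - pt x) *: _]mulr1.
by rewrite subrK.
Qed.

End Polynomials.

(** * Derivatives at a minimum point *)

Section MinimumPoints.
Variables (R : realType) (m : nat).
Implicit Types (u v w : CI R m).

(** The conclusion covers a whole interval to the right of x because the mean
    value theorem yields intermediate points over which there is no control. *)
Lemma near_right (x : unitI R) (P : set (unitI R)) :
  pt x < 1 -> x^' P ->
  exists2 y, pt x < pt y & forall z, pt x < pt z <= pt y -> P z.
Proof.
move=> x1 /nbhs_unitIP[d d0 dP].
have [|y yE] := @ptI R (pt x + Num.min (d / 2) (1 - pt x)).
  have := pt_ge0 x; have : Num.min (d / 2) (1 - pt x) <= 1 - pt x.
    by rewrite ge_min lexx orbT.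
  have : 0 <= Num.min (d / 2) (1 - pt x) by rewrite le_min; lra.
  lra.
have y2 : pt y <= pt x + d / 2 by rewrite yE lerD2l ge_min lexx.
exists y; first by rewrite yE ltrDl lt_min subr_gt0 x1 divr_gt0.
move=> z /andP[xz zy]; apply: dP.
  by rewrite gtr0_norm ?subr_gt0//; lra.
by apply/eqP => zx; rewrite zx ltxx in xz.
Qed.

Lemma near_left (x : unitI R) (P : set (unitI R)) :
  0 < pt x -> x^' P ->
  exists2 y, pt y < pt x & forall z, pt y <= pt z < pt x -> P z.
Proof.
move=> x0 /nbhs_unitIP[d d0 dP].
have [|y yE] := @ptI R (pt x - Num.min (d / 2) (pt x)).
  have := pt_le1 x; have : Num.min (d / 2) (pt x) <= pt x.
    by rewrite ge_min lexx orbT.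
  have : 0 <= Num.min (d / 2) (pt x) by rewrite le_min; lra.
  lra.
have y2 : pt x - d / 2 <= pt y by rewrite yE lerD2l lerN2 ge_min lexx.
exists y; first by rewrite yE ltrBlDr ltrDl lt_min x0 divr_gt0.
move=> z /andP[yz zx]; apply: dP.
  by rewrite ltr0_norm ?subr_lt0//; lra.
by apply/eqP => xz; rewrite xz ltxx in zx.
Qed.

Lemma deriv_ge0_at_min u v i x : is_deriv u v ->
  (forall y, u x i 0 <= u y i 0) -> pt x < 1 -> 0 <= v x i 0.
Proof.
move=> uv umin x1; rewrite leNgt; apply/negP => v0.
have /(cvgr_lt (v x i 0)) /(_ _ v0) := is_deriv_coord (x := x) (i := i) uv.
move=> /(near_right x1)[y xy /(_ y)]; rewrite xy lexx => /(_ isT).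
by apply/negP; rewrite -leNgt mulr_ge0// ?invr_ge0 ?subr_ge0// ltW.
Qed.

Lemma deriv_le0_at_min u v i x : is_deriv u v ->
  (forall y, u x i 0 <= u y i 0) -> 0 < pt x -> v x i 0 <= 0.
Proof.
move=> uv umin x0; rewrite leNgt; apply/negP => v0.
have /(cvgr_gt (v x i 0)) /(_ _ v0) := is_deriv_coord (x := x) (i := i) uv.
move=> /(near_left x0)[y xy /(_ y)]; rewrite xy lexx => /(_ isT).
by apply/negP; rewrite -leNgt mulr_le0_ge0// ?invr_le0 ?subr_le0 ?subr_ge0// ltW.
Qed.

(** If the second derivative were negative, the first one, which vanishes at x,
    would be negative just to the right of x, and the function would fall
    below its minimum. *)
Lemma deriv2_ge0_at_min u v w i x : is_deriv u v -> is_deriv v w ->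
  (forall y, u x i 0 <= u y i 0) -> 0 < pt x < 1 -> 0 <= w x i 0.
Proof.
move=> uv vw umin /andP[x0 x1]; rewrite leNgt; apply/negP => w0.
have vx : v x i 0 = 0.
  by apply/eqP; rewrite eq_le (deriv_le0_at_min uv)// (deriv_ge0_at_min uv).
have /(cvgr_lt (w x i 0)) /(_ _ w0) := is_deriv_coord (x := x) (i := i) vw.
move=> /(near_right x1)[y xy yP].
have [z /andP[xz zy] E] := CI_MVT i uv xy.
have := umin y; rewrite -subr_ge0 E leNgt => /negP; apply.
have := yP z; rewrite xz ltW// => /(_ isT).
rewrite vx subr0 pmulr_rlt0 ?invr_gt0 ?subr_gt0// => vz.
by rewrite pmulr_llt0// subr_gt0.
Qed.

End MinimumPoints.

(** * The maximum principle for one implicit Euler step *)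

Section Dissipativity.
Variables (R : realType) (m : nat) (sigma : 'rV[R]_m).
Variables (K00 K01 K10 K11 : 'M[R]_m).
Implicit Types (u f : CI R m).

(** The two slope conditions say that phi times the vector of ones is a strict
    supersolution of the boundary conditions: its slope is smaller at 0, and
    larger at 1, than they prescribe.  The last one bounds the diffusion
    operator on phi by mu, hence by mu phi as soon as mu >= 0. *)
Definition barrier (phi : {poly R}) (mu : R) : Prop :=
  [/\ forall x : unitI R, 1 <= phi.[pt x],
      forall i, phi^`().[0] < \sum_j (K00 i j * phi.[0] + K01 i j * phi.[1]),
      forall i, \sum_j (K10 i j * phi.[0] + K11 i j * phi.[1]) < phi^`().[1]
    & forall i (x : unitI R), sigma 0 i * phi^`()^`().[pt x] <= mu].

Definition above (phi : {poly R}) (c : R) u : Prop :=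
  forall x i, - (c * phi.[pt x]) <= u x i 0.

Hypothesis sigma_gt0 : forall i, 0 < sigma 0 i.
Hypothesis off_diag : forall i j, i != j -> K00 i j <= 0 /\ 0 <= K11 i j.
Hypothesis coupling : forall i j, K01 i j <= 0 /\ 0 <= K10 i j.

(** The function u + q phi is nonnegative and its component i vanishes at x.
    At x = 0 its slope would have to be nonnegative; but u >= - q phi, with
    equality in component i, and the sign conditions bound the prescribed slope
    of u_i by that of - q phi under the boundary conditions, so that the
    steepness of phi makes the slope negative.  Likewise at x = 1.  So x is an
    interior point, where the second derivative test applies.  The diagonal
    entries of K00 and K11 may have any sign because component i enters with
    equality. *)
Lemma range_A_lower_bound phi mu u f q x i :
  barrier phi mu -> 0 <= mu -> 0 < q ->
  A_Phi sigma K00 K01 K10 K11 u f -> above phi q u ->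
  u x i 0 = - (q * phi.[pt x]) -> - (q * mu) <= f x i 0.
Proof.
move=> [phi1 phi_slope0 phi_slope1 phi_curv] mu0 q0.
move=> [v [w [[uv vw] bc0 bc1 fw]]] uq uxi.
have dg := is_derivD uv (is_deriv_polyCI (m := m) (p := fun=> q *: phi)).
have ddg := is_derivD vw (is_deriv_polyCI (m := m) (p := fun=> (q *: phi)^`())).
set g := u + _ in dg; set g1 := v + _ in dg ddg; set g2 := w + _ in ddg.
have gE y j : g y j 0 = u y j 0 + q * phi.[pt y].
  by rewrite !mxE /= hornerZ.
have g1E y j : g1 y j 0 = v y j 0 + q * phi^`().[pt y].
  by rewrite !mxE /= derivZ hornerZ.
have g2E y j : g2 y j 0 = w y j 0 + q * phi^`()^`().[pt y].
  by rewrite !mxE /= !derivZ hornerZ.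
have gmin y : g x i 0 <= g y i 0.
  by rewrite !gE uxi addNr -lerBlDr sub0r.
have excess y j : 0 <= u y j 0 + q * phi.[pt y] by rewrite -lerBlDr sub0r.
have [x0|x_gt0] := leP (pt x) 0.
  have {x0} x0 : x = I0 by apply: pt_inj; apply/eqP; rewrite eq_le x0 pt_ge0.
  exfalso; have := deriv_ge0_at_min (x := x) dg gmin.
  rewrite x0 => /(_ ltr01); rewrite g1E bc0 !mxE; apply/negP; rewrite -ltNge.
  rewrite -big_split /=.
  apply: (@le_lt_trans _ _ 
      (- (q * \sum_j (K00 i j * phi.[0] + K01 i j * phi.[1]))
       + q * phi^`().[0])); last by rewrite addrC subr_lt0 ltr_pM2l.
  rewrite lerD2r mulr_sumr -sumrN; apply: ler_sum => j _.
  have [k01 _] := coupling i j.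
  have b1 := mulr_le0_ge0 k01 (excess I1 j).
  have [ji|ij] := eqVneq i j.
    by rewrite -ji in b1 *; rewrite x0 in uxi; rewrite uxi /= in b1 *; lra.
  have [k00 _] := off_diag ij.
  have b0 := mulr_le0_ge0 k00 (excess I0 j).
  by rewrite /= in b0 b1; lra.
have [x1|x_lt1] := leP 1 (pt x).
  have {x1} x1 : x = I1 by apply: pt_inj; apply/eqP; rewrite eq_le x1 pt_le1.
  exfalso; have := deriv_le0_at_min (x := x) dg gmin.
  rewrite x1 => /(_ ltr01); rewrite g1E bc1 !mxE; apply/negP; rewrite -ltNge.
  rewrite -big_split /=.
  apply: (@lt_le_trans _ _ 
      (- (q * \sum_j (K10 i j * phi.[0] + K11 i j * phi.[1]))
       + q * phi^`().[1])); first by rewrite addrC subr_gt0 ltr_pM2l.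
  rewrite lerD2r mulr_sumr -sumrN; apply: ler_sum => j _.
  have [_ k10] := coupling i j.
  have b0 := mulr_ge0 k10 (excess I0 j).
  have [ji|ij] := eqVneq i j.
    by rewrite -ji in b0 *; rewrite x1 in uxi; rewrite uxi /= in b0 *; lra.
  have [_ k11] := off_diag ij.
  have b1 := mulr_ge0 k11 (excess I1 j).
  by rewrite /= in b0 b1; lra.
have := deriv2_ge0_at_min dg ddg gmin; rewrite x_gt0 x_lt1 => /(_ isT).
rewrite g2E -(pmulr_rge0 _ (sigma_gt0 i)) mulrDr => w0.
have -> : f x i 0 = sigma 0 i * w x i 0.
  by rewrite fw mul_diag_mx mxE.
have := phi_curv i x; rewrite -(ler_pM2l q0); lra.
Qed.

(** Only the least q with u >= - q phi has to be bounded.  It is attained in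
    some component i at some point x, and there the component i of
    u - h A u is at most - q (1 - h mu) phi. *)
Lemma resolvent_lower_bound phi mu u f h c :
  barrier phi mu -> 0 <= mu -> A_Phi sigma K00 K01 K10 K11 u f ->
  0 <= h -> h * mu < 1 -> 0 <= c ->
  above phi c (u - h *: f) -> above phi (c / (1 - h * mu)) u.
Proof.
move=> bar mu0 uf h0 hmu c0 ufc.
have [phi1 _ _ _] := bar.
have phi_gt0 y : 0 < phi.[pt y] by exact: lt_le_trans (phi1 y).
have D0 : 0 < 1 - h * mu by rewrite subr_gt0.
move=> x0 i0; rewrite leNgt; apply/negP => u_lt.
have cont j : continuous (fun y => u y j 0 / phi.[pt y]).
  move=> y; apply: (@cvgM _ _ (nbhs y)); first exact: CI_coord_continuous.
  apply: (@cvgV _ _ (nbhs y)); first by rewrite gt_eqF.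
  apply: (@continuous_comp _ _ _ (@pt R) (horner phi)).
    exact: pt_continuous.
  exact: continuous_horner.
(* X j is a minimum point of u_j / phi; the least q is attained at X i for the
   component i with the smallest minimum. *)
have [X Xmin] := choice (fun j => EVT_min_unitI (cont j)).
pose F j := u (X j) j 0 / phi.[pt (X j)].
have [i _ imin] := @arg_minP _ _ _ i0 predT F isT.
pose q := - F i.
have u_ge : above phi q u.
  move=> y j; rewrite mulNr opprK -ler_pdivlMr//.
  by rewrite (le_trans _ (Xmin j y))// imin.
have qE : u (X i) i 0 = - (q * phi.[pt (X i)]).
  by rewrite mulNr opprK divfK// gt_eqF.
have q_gt : c / (1 - h * mu) < q.
  have := le_lt_trans (u_ge x0 i0) u_lt.
  by rewrite ltrN2 ltr_pM2r.
have q0 : 0 < q by apply: le_lt_trans q_gt; rewrite divr_ge0// ltW.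
have := range_A_lower_bound bar mu0 q0 uf u_ge qE.
move=> /(ler_wpM2l h0).
have := ufc (X i) i; rewrite !mxE qE.
move: q_gt; rewrite ltr_pdivrMr// -(ltr_pM2r (phi_gt0 (X i))).
have : 0 <= (h * (q * mu)) * (phi.[pt (X i)] - 1).
  by rewrite mulr_ge0 ?subr_ge0// !mulr_ge0// ltW.
lra.
Qed.
End Dissipativity.

(** * Existence of a barrier *)

Section BarrierExists.
Variables (R : realType) (m : nat) (sigma : 'rV[R]_m).
Variables (K00 K01 K10 K11 : 'M[R]_m).
Hypothesis sigma_gt0 : forall i, 0 < sigma 0 i.

(** For N >= 2 its values at the endpoints do not depend on N, whereas its
    slopes there are - N and N. *)
Definition steep_poly (N : nat) : {poly R} := 1 + 'X ^+ N + (1 - 'X) ^+ N.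

Lemma steep_poly_ends n :
  (steep_poly n.+2).[0] = 2 /\ (steep_poly n.+2).[1] = 2.
Proof.
by rewrite /steep_poly !hornerE /= !subrr !subr0 !expr0n /= !expr1n; split; lra.
Qed.

Lemma steep_poly_slopes n : (steep_poly n.+2)^`().[0] = - n.+2%:R /\
  (steep_poly n.+2)^`().[1] = n.+2%:R.
Proof.
rewrite /steep_poly !derivD derivC derivXn deriv_exp derivB derivC derivX.
rewrite -['X^_ *+ _]scaler_nat -[_ * _ *+ _]scaler_nat.
move: (n.+2%:R : R) => N.
by rewrite !hornerE /= ?subrr ?subr0 ?expr0n /= ?expr1n; split; lra.
Qed.

Lemma poly_bounded_unitI (p : {poly R}) :
  exists2 M, 0 <= M & forall x : unitI R, p.[pt x] <= M.
Proof.
exists `|polyCI (fun _ : 'I_1 => p)| => // x.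
have := coord_le_norm (polyCI (fun _ : 'I_1 => p)) x 0.
by rewrite polyCIE; apply: le_trans; exact: ler_norm.
Qed.

Lemma barrier_exists : exists phi mu,
  [/\ barrier sigma K00 K01 K10 K11 phi mu, 0 <= mu &
      exists2 C, 0 < C & forall x : unitI R, phi.[pt x] <= C].
Proof.
pose k := \sum_i \sum_j (`|K00 i j| + `|K01 i j| + `|K10 i j| + `|K11 i j|).
have row_le (f : 'I_m -> 'I_m -> R) i :
    (forall i j, f i j <= `|K00 i j| + `|K01 i j| + `|K10 i j| + `|K11 i j|) ->
    \sum_j f i j <= k.
  move=> fK; rewrite /k [leRHS](bigD1 i)//= -[leLHS]addr0 lerD ?ler_sum//.
  by apply: sumr_ge0 => *; apply: sumr_ge0 => *; rewrite !addr_ge0.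
(* The factor 2 is the value of the barrier at both endpoints. *)
have [n nk] : exists n : nat, 2 * k < n%:R.
  by exists (Num.truncn (2 * k)).+1; exact: truncnS_gt.
have nk2 : 2 * k < n.+2%:R by rewrite (lt_le_trans nk)// ler_nat leqW// leqW.
have [e0 e1] := steep_poly_ends n; have [s0 s1] := steep_poly_slopes n.
have [M M0 MP] := poly_bounded_unitI (steep_poly n.+2)^`()^`().
exists (steep_poly n.+2), ((\sum_i sigma 0 i) * M); split; first split.
- move=> x; rewrite /steep_poly !hornerE /= -addrA lerDl.
  rewrite addr_ge0// exprn_ge0 ?pt_ge0//.
  by rewrite subr_ge0 pt_le1.
- move=> i; rewrite e0 e1 s0 ltrNl -sumrN.
  apply: le_lt_trans nk2; rewrite -ler_pdivrMl// mulr_sumr.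
  apply: (row_le (fun i j => 2^-1 * - (K00 i j * 2 + K01 i j * 2))) => {}i j.
  have := ler_norm (- K00 i j); have := ler_norm (- K01 i j); rewrite !normrN.
  by have := normr_ge0 (K10 i j); have := normr_ge0 (K11 i j); lra.
- move=> i; rewrite e0 e1 s1.
  apply: le_lt_trans nk2; rewrite -ler_pdivrMl// mulr_sumr.
  apply: (row_le (fun i j => 2^-1 * (K10 i j * 2 + K11 i j * 2))) => {}i j.
  have := ler_norm (K10 i j); have := ler_norm (K11 i j).
  by have := normr_ge0 (K00 i j); have := normr_ge0 (K01 i j); lra.
- move=> i x; apply: le_trans (_ : sigma 0 i * M <= _).
    by rewrite ler_wpM2l// ltW.
  rewrite ler_wpM2r// (bigD1 i)//= lerDl sumr_ge0// => j _; exact: ltW.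
- by rewrite mulr_ge0// sumr_ge0// => j _; exact: ltW.
- have [C C0 CP] := poly_bounded_unitI (steep_poly n.+2).
  by exists (C + 1); [lra|move=> x; have := CP x; lra].
Qed.
End BarrierExists.

(** * Correcting the slopes at the endpoints *)

Section BoundaryCorrection.
Variables (R : realType) (m : nat) (sigma : 'rV[R]_m).
Variables (K00 K01 K10 K11 : 'M[R]_m).

(** The two bumps vanish at both endpoints, with slopes (1, 0) and (0, -1), so
    that the correction changes the slopes of p but not its boundary values.
    The exponent is at least 3 so that each bump is also flat to second order
    at the endpoint where its slope is 0. *)
Definition boundary_correction (p : 'I_m -> {poly R}) n (i : 'I_m) : {poly R} :=
  let at0 := \col_j (p j).[0] in let at1 := \col_j (p j).[1] in
  p i + ((K00 *m at0 + K01 *m at1) i 0 - (p i)^`().[0]) *: ('X * (1 - 'X) ^+ n.+3)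
      - ((K10 *m at0 + K11 *m at1) i 0 - (p i)^`().[1]) *: ('X ^+ n.+3 * (1 - 'X)).

Lemma boundary_correction0 p n i : (boundary_correction p n i).[0] = (p i).[0].
Proof. by rewrite /boundary_correction !hornerE /= ?subr0 ?expr0n /=; lra. Qed.

Lemma boundary_correction1 p n i : (boundary_correction p n i).[1] = (p i).[1].
Proof. by rewrite /boundary_correction !hornerE /= ?subrr; lra. Qed.

Lemma deriv_expX n : ('X ^+ n.+1)^`() = n.+1%:R *: 'X ^+ n :> {poly R}.
Proof. by rewrite derivXn -scaler_nat. Qed.

Lemma deriv_exp1X n :
  ((1 - 'X) ^+ n.+1)^`() = - (n.+1%:R *: (1 - 'X) ^+ n) :> {poly R}.
Proof.
by rewrite deriv_exp derivB derivC derivX sub0r mulN1r mulNrn -scaler_nat.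
Qed.

Lemma left_bump_deriv n : ('X * (1 - 'X) ^+ n.+1)^`() =
  (1 - 'X) ^+ n.+1 - n.+1%:R *: ('X * (1 - 'X) ^+ n) :> {poly R}.
Proof. by rewrite derivM deriv_exp1X derivX mul1r mulrN scalerAr. Qed.

Lemma right_bump_deriv n : ('X ^+ n.+1 * (1 - 'X))^`() =
  n.+1%:R *: ('X ^+ n * (1 - 'X)) - 'X ^+ n.+1 :> {poly R}.
Proof.
by rewrite derivM deriv_expX derivB derivC derivX sub0r mulrN1 -scalerAl.
Qed.

Lemma boundary_correction_in_domain p n :
  A_Phi sigma K00 K01 K10 K11 (polyCI (boundary_correction p n))
    (polyCI (fun i => sigma 0 i *: (boundary_correction p n i)^`()^`())).
Proof.
exists (polyCI (fun i => (boundary_correction p n i)^`())),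
  (polyCI (fun i => (boundary_correction p n i)^`()^`())).
have E0 : polyCI (boundary_correction p n) I0 = \col_j (p j).[0].
  by apply/matrixP => i j; rewrite !mxE /= boundary_correction0.
have E1 : polyCI (boundary_correction p n) I1 = \col_j (p j).[1].
  by apply/matrixP => i j; rewrite !mxE /= boundary_correction1.
split; first by split; exact: is_deriv_polyCI.
- rewrite E0 E1; apply/matrixP => i j.
  rewrite ord1 polyCIE /= /boundary_correction.
  move: (_ i 0) (_ i 0) => a b.
  rewrite derivB derivD !derivZ left_bump_deriv right_bump_deriv.
  move: (n.+3%:R : R) => N.
  rewrite (_ : pt I0 = 0)// !hornerE ?subr0 ?expr1n ?expr0n /=.
  by lra.
- rewrite E0 E1; apply/matrixP => i j.
  rewrite ord1 polyCIE /= /boundary_correction.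
  move: (_ i 0) (_ i 0) => a b.
  rewrite derivB derivD !derivZ left_bump_deriv right_bump_deriv.
  move: (n.+3%:R : R) => N.
  rewrite (_ : pt I1 = 1)// !hornerE ?subrr ?expr1n ?expr0n /=.
  by lra.
- by move=> x; apply/matrixP => i j; rewrite mul_diag_mx !mxE /= hornerZ.
Qed.

End BoundaryCorrection.

Section BumpEstimates.
Variable R : realType.
Implicit Types (a b c d x e : R) (n : nat).

(** Bernoulli's inequality bounds (1 + n x) (1 - x)^n by (1 - x^2)^n <= 1. *)
Lemma bump_le (x : R) n : 0 <= x <= 1 -> n%:R * (x * (1 - x) ^+ n) <= 1.
Proof.
move=> /andP[x0 x1].
have bern : 1 + n%:R * x <= (1 + x) ^+ n.
  elim: n => [|n IH]; first by rewrite mul0r addr0 expr0.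
  rewrite exprSr; apply: (@le_trans _ _ ((1 + n%:R * x) * (1 + x))); last first.
    by rewrite ler_wpM2r// addr_ge0.
  have : 0 <= n%:R * x * x by rewrite !mulr_ge0.
  by rewrite -natr1; lra.
have y0 : 0 <= (1 - x) ^+ n by rewrite exprn_ge0// subr_ge0.
have : (1 + n%:R * x) * (1 - x) ^+ n <= 1.
  apply: le_trans (ler_wpM2r y0 bern) _; rewrite -exprMn.
  by apply: exprn_ile1; nra.
by lra.
Qed.

Lemma small_bump x n : 0 <= x <= 1 ->
  0 <= x * (1 - x) ^+ n.+3 /\ n%:R * (x * (1 - x) ^+ n.+3) <= 1.
Proof.
move=> x01; have /andP[x0 x1] := x01.
have y0 : 0 <= 1 - x by rewrite subr_ge0.
split; first by rewrite mulr_ge0// exprn_ge0.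
apply: le_trans (bump_le n x01); rewrite ler_wpM2l// ler_wpM2l//.
by rewrite -addn3 exprD ler_piMr ?exprn_ge0// exprn_ile1//; lra.
Qed.

Lemma bumps_le c d e x n :
  0 <= x <= 1 -> `|c| + `|d| <= e * n%:R -> (0 < n)%N ->
  `|c * (x * (1 - x) ^+ n.+3) - d * (x ^+ n.+3 * (1 - x))| <= e.
Proof.
move=> x01 cde n0; have [g0 g1] := small_bump n x01.
have y01 : 0 <= 1 - x <= 1 by lra.
have [] := small_bump n y01; rewrite subKr mulrC => h0 h1.
move: (x * _) (x ^+ _ * _) g0 g1 h0 h1 => g h g0 g1 h0 h1.
have n0' : 0 < n%:R :> R by rewrite ltr0n.
rewrite -(ler_pM2r n0') (le_trans _ cde)//.
apply: le_trans (ler_wpM2r (ltW n0') (ler_normB _ _)) _.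
rewrite !normrM (ger0_norm g0) (ger0_norm h0) mulrDl.
have cc : 0 <= `|c| by []; have dd : 0 <= `|d| by [].
by apply: lerD; rewrite -mulrA ler_piMr// mulrC.
Qed.

(** The sum vanishes at x = 0, so a uniform bound on the bumps is not enough:
    near 0 the last bump is of order at least x^3 and is dominated by the first term,
    of order x^2. *)
Lemma vanishing_test_ge0 b c d x n :
  0 <= x <= 1 -> 0 <= b -> 0 <= c -> `|d| <= b * n%:R ->
  0 <= b * (3 * x ^+ 2 - 2 * x ^+ 3)
       + c * (x * (1 - x) ^+ n.+3) - d * (x ^+ n.+3 * (1 - x)).
Proof.
move=> x01 b0 c0 db; have /andP[x0 x1] := x01.
have [g0 _] := small_bump n x01.
have y01 : 0 <= 1 - x <= 1 by lra.
have := bump_le n y01; rewrite subKr => h1.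
have h0 : 0 <= (1 - x) * x ^+ n by rewrite mulr_ge0 ?exprn_ge0//; lra.
rewrite addrAC; apply: addr_ge0; last by rewrite mulr_ge0.
have -> : x ^+ n.+3 * (1 - x) = x ^+ 3 * ((1 - x) * x ^+ n).
  by rewrite -addn3 exprD; ring.
move: (_ * x ^+ n) h0 h1 => h h0 h1.
have dh : d * h <= b.
  apply: (le_trans (ler_wpM2r h0 (ler_norm d))).
  apply: (le_trans (ler_wpM2r h0 db)).
  by rewrite -mulrA ler_piMr.
have : 0 <= x ^+ 3 * (b - d * h) by rewrite mulr_ge0 ?exprn_ge0// subr_ge0.
have : 0 <= b * (x ^+ 2 * (1 - x)) by rewrite !mulr_ge0 ?exprn_ge0// subr_ge0.
lra.
Qed.
End BumpEstimates.

(** * Necessity of the sign conditions *)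

Section NonpositiveRows.
Variables (R : realType) (m : nat).

(** Any entry except a_i = 0 may be arbitrarily large while all the remaining
    ones equal 1, so each coefficient other than r_i is the
    limit slope of a quantity that stays nonpositive. *)
Lemma row_nonpositive (r s : 'rV[R]_m) (i : 'I_m) :
  (forall a b : 'cV[R]_m, a i 0 = 0 -> (forall k, k != i -> 0 < a k 0) ->
     (forall k, 0 < b k 0) -> (r *m a + s *m b) 0 0 <= 0) ->
  (forall j, i != j -> r 0 j <= 0) /\ (forall j, s 0 j <= 0).
Proof.
move=> H; pose a0 : 'cV[R]_m := \col_k (k != i)%:R.
pose b0 : 'cV[R]_m := const_mx 1.
have large (S c : R) : (forall t, 0 <= t -> S + t * c <= 0) -> c <= 0.
  move=> Sc; rewrite leNgt; apply/negP => c0.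
  have := Sc (`|S| / c + 1); rewrite addr_ge0 ?divr_ge0// ?(ltW c0)// => /(_ isT).
  rewrite mulrDl divfK ?gt_eqF// mul1r; have := ler_norm (- S).
  by rewrite normrN; lra.
have deltaE (q : 'rV[R]_m) j : (q *m delta_mx j 0) 0 0 = q 0 j :> R.
  rewrite mxE (bigD1 j)//= mxE !eqxx mulr1 big1 ?addr0// => k kj.
  by rewrite mxE (negbTE kj) mulr0.
split=> [j ij|j]; apply: (large ((r *m a0 + s *m b0) 0 0)) => t t0.
- have := H (a0 + t *: delta_mx j 0) b0.
  have -> : r *m (a0 + t *: delta_mx j 0) + s *m b0 =
      r *m a0 + s *m b0 + t *: (r *m delta_mx j 0).
    by rewrite mulmxDr -scalemxAr addrAC.
  have -> (A B : 'M[R]_1) : (A + t *: B) 0 0 = A 0 0 + t * B 0 0.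
    by rewrite !mxE.
  rewrite deltaE; apply.
  + by rewrite !mxE eqxx (negbTE ij) mulr0 addr0.
  + by move=> k ki; rewrite !mxE ki ltr_pwDl// mulr_ge0.
  + by move=> k; rewrite mxE.
- have := H a0 (b0 + t *: delta_mx j 0).
  have -> : r *m a0 + s *m (b0 + t *: delta_mx j 0) =
      r *m a0 + s *m b0 + t *: (s *m delta_mx j 0).
    by rewrite mulmxDr -scalemxAr addrA.
  have -> (A B : 'M[R]_1) : (A + t *: B) 0 0 = A 0 0 + t * B 0 0.
    by rewrite !mxE.
  rewrite deltaE; apply.
  + by rewrite !mxE eqxx.
  + by move=> k ki; rewrite !mxE ki.
  + by move=> k; rewrite !mxE ltr_pwDl// mulr_ge0.
Qed.
End NonpositiveRows.

Section Necessity.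
Variables (R : realType) (m : nat) (sigma : 'rV[R]_m).
Variables (K00 K01 K10 K11 : 'M[R]_m).
Hypothesis sigma_gt0 : forall i, 0 < sigma 0 i.
Implicit Types (a b : 'cV[R]_m).

(** The cubic that interpolates a_i and b_i with slope 0 at both endpoints; its
    slopes are then set by the boundary correction alone. *)
Definition hermite a b (i : 'I_m) : {poly R} :=
  (a i 0)%:P + (b i 0 - a i 0) *: ('X * 'X * (3%:P - 2 *: 'X)).

Lemma deriv_hermite a b i :
  (hermite a b i)^`() = (b i 0 - a i 0) *: (6 *: ('X * (1 - 'X))).
Proof.
rewrite /hermite derivD derivC derivZ !derivM derivX derivB derivC derivZ derivX.
rewrite add0r; congr (_ *: _); rewrite -!mul_polyC.
rewrite (_ : 6 = 3 + 3 :> R); last by lra.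
by rewrite (_ : 3 = 2 + 1 :> R); [rewrite !polyCD; ring|lra].
Qed.

Definition test_poly a b n :=
  boundary_correction K00 K01 K10 K11 (hermite a b) n.

Lemma test_polyE a b n k : test_poly a b n k = hermite a b k
  + (K00 *m a + K01 *m b) k 0 *: ('X * (1 - 'X) ^+ n.+3)
  - (K10 *m a + K11 *m b) k 0 *: ('X ^+ n.+3 * (1 - 'X)).
Proof.
have h0 : \col_j (hermite a b j).[0] = a.
  apply/matrixP => i j; rewrite ord1 mxE /hermite !hornerE /=.
  by lra.
have h1 : \col_j (hermite a b j).[1] = b.
  apply/matrixP => i j; rewrite ord1 mxE /hermite !hornerE /=.
  by lra.
have d0 : (hermite a b k)^`().[0] = 0.
  by rewrite deriv_hermite !hornerE /= ?subrr ?mulr0 ?mul0r.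
have d1 : (hermite a b k)^`().[1] = 0.
  by rewrite deriv_hermite !hornerE /= ?subrr ?mulr0 ?mul0r.
by rewrite /test_poly /boundary_correction h0 h1 d0 d1 !subr0.
Qed.

Lemma test_poly_horner a b n k x : (test_poly a b n k).[x] =
  a k 0 + (b k 0 - a k 0) * (3 * x ^+ 2 - 2 * x ^+ 3)
  + (K00 *m a + K01 *m b) k 0 * (x * (1 - x) ^+ n.+3)
  - (K10 *m a + K11 *m b) k 0 * (x ^+ n.+3 * (1 - x)).
Proof.
have one : (1 : {poly R}).[x] = 1 by rewrite -polyC1 hornerC.
rewrite test_polyE /hermite.
move: ((K00 *m a + K01 *m b) k 0) ((K10 *m a + K11 *m b) k 0) => c d.
rewrite !(horner_exp, hornerD, hornerN, hornerZ, hornerM, hornerX, hornerC, one).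
by ring.
Qed.

Lemma test_poly_deriv2 a b n k :
  (test_poly a b n k)^`()^`().[0] =
    6 * (b k 0 - a k 0) - 2 * n.+3%:R * (K00 *m a + K01 *m b) k 0 /\
  (test_poly a b n k)^`()^`().[1] =
    2 * n.+3%:R * (K10 *m a + K11 *m b) k 0 - 6 * (b k 0 - a k 0).
Proof.
rewrite test_polyE.
move: ((K00 *m a + K01 *m b) k 0) ((K10 *m a + K11 *m b) k 0) => c d.
have -> : (hermite a b k + c *: ('X * (1 - 'X) ^+ n.+3)
      - d *: ('X ^+ n.+3 * (1 - 'X)))^`() =
    (b k 0 - a k 0) *: (6 *: ('X * (1 - 'X)))
    + c *: ((1 - 'X) ^+ n.+3 - n.+3%:R *: ('X * (1 - 'X) ^+ n.+2))
    - d *: (n.+3%:R *: ('X ^+ n.+2 * (1 - 'X)) - 'X ^+ n.+3).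
  by rewrite derivB derivD deriv_hermite !derivZ left_bump_deriv right_bump_deriv.
rewrite derivB derivD !derivZ !derivB !derivZ derivM derivB derivX derivC.
rewrite deriv_exp1X deriv_expX left_bump_deriv right_bump_deriv -!natr1.
move: (n%:R : R) => N.
rewrite !(horner_exp, hornerD, hornerN, hornerZ, hornerM, hornerX, hornerC).
rewrite !subr0 !subrr !expr1n !exprS !mul0r.
by split; ring.
Qed.

(** The cubic stays between a_k and b_k, and for large n the bumps are smaller
    than both. *)
Lemma test_poly_ge0_component a b n k (x : R) : 0 <= x <= 1 -> (0 < n)%N ->
  0 < a k 0 -> 0 < b k 0 ->
  `|(K00 *m a + K01 *m b) k 0| + `|(K10 *m a + K11 *m b) k 0|
    <= Num.min (a k 0) (b k 0) * n%:R ->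
  0 <= (test_poly a b n k).[x].
Proof.
move=> x01 n0 ak bk kn; have /andP[x0 x1] := x01.
rewrite test_poly_horner.
have := bumps_le x01 kn n0; rewrite ler_norml => /andP[H _].
have mina : Num.min (a k 0) (b k 0) <= a k 0 by rewrite ge_min lexx.
have minb : Num.min (a k 0) (b k 0) <= b k 0 by rewrite ge_min lexx orbT.
have s0 : 0 <= 3 * x ^+ 2 - 2 * x ^+ 3.
  have : 0 <= x ^+ 2 * (3 - 2 * x) by rewrite mulr_ge0 ?exprn_ge0//; lra.
  lra.
have s1 : 0 <= 1 - (3 * x ^+ 2 - 2 * x ^+ 3).
  have : 0 <= (1 - x) ^+ 2 * (1 + 2 * x) by rewrite mulr_ge0 ?exprn_ge0//; lra.
  lra.
have : 0 <= (3 * x ^+ 2 - 2 * x ^+ 3) * (b k 0 - Num.min (a k 0) (b k 0)).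
  by rewrite mulr_ge0// subr_ge0.
have : 0 <= (1 - (3 * x ^+ 2 - 2 * x ^+ 3)) * (a k 0 - Num.min (a k 0) (b k 0)).
  by rewrite mulr_ge0// subr_ge0.
move: H; move: (_ * (x * _)) (_ * (x ^+ n.+3 * _)) => g h; lra.
Qed.

(** At a zero of u_i the difference quotient of the orbit is T(h) u / h, which
    is nonnegative. *)
Lemma generator_positive_minimum (T : R -> CI R m -> CI R m) u f x i :
  positive_semigroup T -> generator T u f -> nonneg_fun u -> u x i 0 = 0 ->
  0 <= f x i 0.
Proof.
move=> posT uf u0 ui0.
have L : (h^-1 *: (T h u - u)) x i 0 @[h --> 0^'+] --> f x i 0.
  apply/cvgrPdist_le => e e0; move/cvgrPdist_le: uf => /(_ e e0).
  apply: filterS => h; apply: le_trans.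
  by have := coord_le_norm (f - h^-1 *: (T h u - u)) x i; rewrite !mxE.
rewrite -(cvg_lim _ L)//; apply: limr_ge.
  by apply/cvg_ex; exists (f x i 0).
near=> h; have h0 : 0 < h by [].
rewrite !mxE ui0 subr0 mulr_ge0 ?invr_ge0 ?(ltW h0)//.
by apply: posT => //; exact: ltW.
Unshelve. all: by end_near. Qed.

(** At 0 the second derivative of the component i of the test polynomial is
    6 b_i - 2 (n + 3) c_i, where c_i > 0 is the prescribed slope: it becomes
    negative for large n. *)
Lemma left_test_function a b i : a i 0 = 0 -> (forall k, k != i -> 0 < a k 0) ->
  (forall k, 0 < b k 0) -> 0 < (K00 *m a + K01 *m b) i 0 ->
  exists u f, [/\ A_Phi sigma K00 K01 K10 K11 u f, nonneg_fun u,
                  u I0 i 0 = 0 & f I0 i 0 < 0].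
Proof.
move=> ai a0 b0 ci.
pose c := K00 *m a + K01 *m b; pose d := K10 *m a + K11 *m b.
near \oo => n.
have n0 : (0 < n)%N by near: n; exact: nbhs_infty_gt.
have nk k : (`|c k 0| + `|d k 0|) / Num.min (a k 0) (b k 0) <= n%:R.
  by move: k; near: n; apply: filter_forall => k; exact: nbhs_infty_ger.
have ni : `|d i 0| / b i 0 <= n%:R by near: n; exact: nbhs_infty_ger.
have nc : 3 * b i 0 / c i 0 <= n%:R by near: n; exact: nbhs_infty_ger.
exists (polyCI (test_poly a b n)).
exists (polyCI (fun i => sigma 0 i *: (test_poly a b n i)^`()^`())).
split; first exact: boundary_correction_in_domain.
- move=> x k; rewrite polyCIE.
  have x01 : 0 <= pt x <= 1 by rewrite pt_ge0 pt_le1.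
  have [->|ki] := eqVneq k i.
    rewrite test_poly_horner ai subr0 add0r.
    apply: vanishing_test_ge0 => //; try exact: ltW.
    by move: ni; rewrite ler_pdivrMr// mulrC.
  apply: test_poly_ge0_component => //; first exact: a0.
  have := nk k; rewrite ler_pdivrMr; first by rewrite mulrC.
  by rewrite lt_min a0//=.
- rewrite polyCIE test_poly_horner ai /= (_ : pt I0 = 0)//.
  by rewrite expr0n /= expr0n /= expr0n /=; lra.
- rewrite polyCIE hornerZ pmulr_rlt0// (test_poly_deriv2 a b n i).1 ai -/c.
  move: nc; rewrite ler_pdivrMr//; have : 0 < c i 0 by [].
  by rewrite -!natr1; lra.
Unshelve. all: by end_near. Qed.

Lemma right_test_function a b i :
  b i 0 = 0 -> (forall k, k != i -> 0 < b k 0) ->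
  (forall k, 0 < a k 0) -> (K10 *m a + K11 *m b) i 0 < 0 ->
  exists u f, [/\ A_Phi sigma K00 K01 K10 K11 u f, nonneg_fun u,
                  u I1 i 0 = 0 & f I1 i 0 < 0].
Proof.
move=> bi b0 a0 di.
pose c := K00 *m a + K01 *m b; pose d := K10 *m a + K11 *m b.
near \oo => n.
have n0 : (0 < n)%N by near: n; exact: nbhs_infty_gt.
have nk k : (`|c k 0| + `|d k 0|) / Num.min (a k 0) (b k 0) <= n%:R.
  by move: k; near: n; apply: filter_forall => k; exact: nbhs_infty_ger.
have ni : `|c i 0| / a i 0 <= n%:R by near: n; exact: nbhs_infty_ger.
have nc : 3 * a i 0 / - d i 0 <= n%:R by near: n; exact: nbhs_infty_ger.
exists (polyCI (test_poly a b n)).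
exists (polyCI (fun i => sigma 0 i *: (test_poly a b n i)^`()^`())).
split; first exact: boundary_correction_in_domain.
- move=> x k; rewrite polyCIE.
  have x01 : 0 <= pt x <= 1 by rewrite pt_ge0 pt_le1.
  have [->|ki] := eqVneq k i.
    (* The reflection x |-> 1 - x exchanges the two bumps. *)
    have y01 : 0 <= 1 - pt x <= 1 by lra.
    have : `|- c i 0| <= a i 0 * n%:R.
      by move: ni; rewrite normrN ler_pdivrMr// mulrC.
    have d0 : 0 <= - d i 0 by rewrite oppr_ge0 ltW.
    move=> /(vanishing_test_ge0 y01 (ltW (a0 i)) d0).
    rewrite test_poly_horner bi -/c -/d subKr.
    move: (c i 0) (d i 0) (a i 0) => ci di' ai.
    rewrite [X in - ci * X]mulrC [X in - di' * X]mulrC.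
    move: (_ ^+ n.+3) (_ ^+ n.+3) => g h; lra.
  apply: test_poly_ge0_component => //; first exact: b0.
  have := nk k; rewrite ler_pdivrMr; first by rewrite mulrC.
  by rewrite lt_min b0// a0.
- rewrite polyCIE test_poly_horner bi /= (_ : pt I1 = 1)// subrr.
  by rewrite !expr1n expr0n /=; lra.
- rewrite polyCIE hornerZ pmulr_rlt0// (test_poly_deriv2 a b n i).2 bi -/d.
  have d0 : 0 < - d i 0 by rewrite oppr_gt0.
  by move: nc; rewrite ler_pdivrMr//; rewrite -!natr1; lra.
Unshelve. all: by end_near. Qed.

Lemma positive_signs (T : R -> CI R m -> CI R m) :
  generates (A_Phi sigma K00 K01 K10 K11) T -> positive_semigroup T ->
  (forall i j, i != j -> K00 i j <= 0 /\ 0 <= K11 i j) /\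
  (forall i j, K01 i j <= 0 /\ 0 <= K10 i j).
Proof.
move=> [_ genT] posT.
have rowE (A B : 'M[R]_m) i (a b : 'cV[R]_m) :
    (row i A *m a + row i B *m b) 0 0 = (A *m a + B *m b) i 0.
  by rewrite -!row_mul -linearD /= mxE.
have left_signs i := @row_nonpositive R m (row i K00) (row i K01) i.
have right_signs i := @row_nonpositive R m (- row i K11) (- row i K10) i.
have {}left_signs i : (forall j, i != j -> row i K00 0 j <= 0) /\
    (forall j, row i K01 0 j <= 0).
  apply: left_signs => a b ai a0 b0; rewrite rowE leNgt; apply/negP => c0.
  have [u [f [/genT uf u0 ui]]] := left_test_function ai a0 b0 c0.
  by apply/negP; rewrite -leNgt (generator_positive_minimum posT uf u0 ui).
have {}right_signs i : (forall j, i != j -> (- row i K11) 0 j <= 0) /\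
    (forall j, (- row i K10) 0 j <= 0).
  apply: right_signs => b a bi b0 a0.
  rewrite !mulNmx -opprD mxE addrC rowE oppr_le0 leNgt; apply/negP => c0.
  have [u [f [/genT uf u0 ui]]] := right_test_function bi b0 a0 c0.
  by apply/negP; rewrite -leNgt (generator_positive_minimum posT uf u0 ui).
split=> [i j ij|i j]; split.
- by have := (left_signs i).1 j ij; rewrite mxE.
- by have := (right_signs i).1 j ij; rewrite !mxE oppr_le0.
- by have := (left_signs i).2 j; rewrite mxE.
- by have := (right_signs i).2 j; rewrite !mxE oppr_le0.
Qed.
End Necessity.

(** * Completeness of the space of continuous vector functions *)

Section Completeness.
Variables (R : realType) (m : nat).

(** The pointwise limit of a Cauchy filter is a uniform limit, hence
    continuous. *)
Lemma CI_complete (F : set_system (CI R m)) :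
  ProperFilter F -> cauchy F -> cvg F.
Proof.
move=> FF /cauchyP Fc.
have Fball e : 0 < e -> exists u0 : CI R m, \forall u \near F, `|u0 - u| < e.
  by move=> /Fc[u0]; rewrite -ball_normE; exists u0.
have Fx x : cvg (u x @[u --> F]).
  apply: cauchy_cvg; apply: cauchy_exP => e /Fball[u0 Fu0].
  exists (u0 x); rewrite -ball_normE; apply: filterS Fu0 => u.
  apply: le_lt_trans.
  exact: le_sup_norm (u0 - u) x.
pose g x : 'cV[R]_m := lim (u x @[u --> F]).
have near_g e (u0 : CI R m) : (\forall u \near F, `|u0 - u| < e) ->
    forall x, `|g x - u0 x| <= e.
  move=> Fu0 x; apply/ler_addgt0Pr => d d0.
  have /cvgrPdist_le /(_ d d0) Fg := Fx x.
  have [u [u0u gu]] := filter_ex (filterI Fu0 Fg).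
  have := ler_distD (u x) (g x) (u0 x).
  move=> /le_trans; apply; rewrite addrC lerD//; last first.
    rewrite distrC (le_trans (le_sup_norm (u0 - u) x))//; exact: ltW.
have g_cont : continuous g.
  move=> x; apply/(@cvgrPdist_le _ _ _ (nbhs x)) => e e0.
  have e3 : 0 < e / 3 by rewrite divr_gt0.
  have [u0 /near_g gu0] := Fball _ e3.
  have /(@cvgrPdist_le _ _ _ (nbhs x)) /(_ _ e3) := @CI_continuous R m u0 x.
  apply: filterS => y u0xy.
  have := ler_distD (u0 x) (g x) (g y); have := ler_distD (u0 y) (u0 x) (g y).
  by have := gu0 x; have := gu0 y; rewrite (distrC (g y)); lra.
apply/cvg_ex; exists (MkCI (asboolT g_cont)).
apply/cvgrPdist_le => e e0.
have [|u0 Fu0] := Fball (e / 2); first by rewrite divr_gt0.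
apply: filterS (Fu0) => u u0u; apply: sup_norm_le => x.
have := ler_distD (u0 x) (g x) (u x) => /le_trans; apply.
rewrite (splitr e) lerD//; first exact: near_g.
by rewrite (le_trans (le_sup_norm (u0 - u) x))// ltW.
Qed.

HB.instance Definition _ := Uniform_isComplete.Build (CI R m) CI_complete.

End Completeness.

(** * Orbits of strongly continuous semigroups *)

Section SemigroupOrbits.
Variables (R : realType) (V : normedModType R) (T : R -> V -> V).
Hypothesis C0T : C0_semigroup T.

Lemma semigroup_linear t : 0 <= t ->
  [/\ forall a u, T t (a *: u) = a *: T t u,
      forall u v, T t (u + v) = T t u + T t v
    & forall u v, T t (u - v) = T t u - T t v].
Proof.
move=> t0; have [/(_ t t0)[lT _] _ _ _] := C0T.
have T0 : T t 0 = 0 by have := lT (-1) 0 0; rewrite scaler0 addr0 scaleN1r addNr.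
have TZ a u : T t (a *: u) = a *: T t u.
  by have := lT a u 0; rewrite !addr0 T0 addr0.
have TD u v : T t (u + v) = T t u + T t v by have := lT 1 u v; rewrite !scale1r.
by split=> // u v; rewrite TD -scaleN1r TZ scaleN1r.
Qed.

Lemma generator_orbit t u f : 0 <= t -> generator T u f ->
  generator T (T t u) (T t f).
Proof.
move=> t0 uf; have [/(_ t t0)[_ cT] _ TD _] := C0T.
have [TZ _ TB] := semigroup_linear t0.
have := cvg_comp _ _ uf (cT f); apply: cvg_trans; apply: near_eq_cvg.
near=> h; have h0 : 0 <= h by [].
by rewrite /= TZ TB -!TD// [h + t]addrC.
Unshelve. all: by end_near. Qed.

(** Along the orbit, u_1 = T(h) u satisfies u_1 - h A u_1 = u + o(h): both
    (T(h) u - u) / h and T(h) A u tend to A u. *)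
Lemma euler_defect_small u f t e : generator T u f -> 0 < t -> 0 < e ->
  exists2 n : nat, (0 < n)%N &
    `|(t / n%:R)^-1 *: (T (t / n%:R) u - u) - T (t / n%:R) f| <= e.
Proof.
move=> uf t0 e0; have [_ _ _ T_cont] := C0T.
have e2 : 0 < e / 2 by rewrite divr_gt0.
have : \forall h \near 0^'+, `|h^-1 *: (T h u - u) - T h f| <= e.
  have /cvgrPdist_le /(_ _ e2) := uf; have /cvgrPdist_le /(_ _ e2) := T_cont f.
  apply: filterS2 => h H1 H2; rewrite (splitr e).
  by apply: le_trans (ler_distD f _ _) _; rewrite lerD// distrC.
move=> /nbhs_ballP[d /= d0 dP].
have [n nd] : exists n : nat, t / d < n%:R.
  by exists (Num.truncn (t / d)).+1; exact: truncnS_gt.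
have n0 : (0 < n)%N by rewrite -(ltr0n R) (lt_trans _ nd)// divr_gt0.
have tn0 : 0 < t / n%:R by rewrite divr_gt0// ltr0n.
exists n => //; apply: dP => //.
rewrite /ball/= sub0r normrN gtr0_norm// ltr_pdivrMr ?ltr0n//.
by move: nd; rewrite ltr_pdivrMr// mulrC.
Qed.
End SemigroupOrbits.

Section LocalBoundedness.
Variables (R : realType) (V : completeNormedModType R).

Lemma continuous_linear_bounded_fun_norm (f : V -> V) :
  linear f -> continuous f -> bounded_fun_norm f.
Proof.
move=> lf cf; pose L := GRing.isLinear.Build R V V _ f lf.
pose g : {linear V -> V} := HB.pack f L.
by apply/(bounded_funP g)/(linear_bounded_continuous g).
Qed.

(** Otherwise there are times s_n -> 0 for which the norms of T(s_n) are
    unbounded.  But T(s_n) u converges for every u, so the uniform boundedness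
    principle applies to the family of the T(s_n).  A whole interval of times
    could not be used instead, since the bound on the orbit of u near time 0
    holds on an interval that depends on u. *)
Lemma C0_semigroup_locally_bounded (T : R -> V -> V) : C0_semigroup T ->
  exists M d, [/\ 0 <= M, 0 < d &
    forall t u, 0 <= t <= d -> `|T t u| <= M * `|u|].
Proof.
move=> C0T; have [lcT T0 _ T_cont] := C0T; apply: contrapT => unbounded.
have /choice[sw swP] (n : nat) : exists tw : R * V,
    [/\ 0 <= tw.1, tw.1 <= n.+1%:R^-1 & n%:R * `|tw.2| < `|T tw.1 tw.2|].
  apply: contrapT => H; apply: unbounded.
  exists n%:R, n.+1%:R^-1; split; rewrite ?invr_gt0// => t u /andP[t0 t1].
  by rewrite leNgt; apply/negP => Tu; apply: H; exists (t, u).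
pose s n := (sw n).1; pose w n := (sw n).2.
have s0 n : 0 <= s n by have [] := swP n.
have s1 n : s n <= n.+1%:R^-1 by have [] := swP n.
have swn n : n%:R * `|w n| < `|T (s n) (w n)| by have [] := swP n.
have T_lin n a u : T (s n) (a *: u) = a *: T (s n) u.
  by have [TZ _ _] := semigroup_linear C0T (s0 n).
pose F := range (fun n => T (s n)).
have F_lin f : F f -> bounded_fun_norm f /\ linear f.
  move=> [n _ <-]; have [lT cT] := lcT _ (s0 n); split=> //.
  exact: continuous_linear_bounded_fun_norm.
have F_ptwise : pointwise_bounded F.
  move=> u; have /cvgrPdist_le /(_ 1 ltr01) := T_cont u.
  move=> /nbhs_ballP[d /= d0 dP].
  have [N NP] : exists N : nat, d^-1 <= N%:R.
    by exists (Num.truncn d^-1).+1; exact/ltW/truncnS_gt.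
  exists (`|u| + 1 + \sum_(n < N) `|T (s n) u|) => _ [n _ <-].
  have [nN|Nn] := ltnP n N.
    rewrite (bigD1 (Ordinal nN))//= addrCA lerDl addr_ge0 ?addr_ge0//.
    by apply: sumr_ge0.
  apply: (@le_trans _ _ (`|u| + 1)); last by rewrite lerDl sumr_ge0.
  have [->|sn0] := eqVneq (s n) 0; first by rewrite T0 lerDl.
  have sn_gt0 : 0 < s n by rewrite lt_neqAle eq_sym sn0 s0.
  rewrite -lerBlDl; apply: le_trans (lerB_dist _ _) _.
  rewrite distrC; apply: dP => //.
  rewrite /ball/= sub0r normrN gtr0_norm// (le_lt_trans (s1 n))//.
  rewrite invf_plt ?posrE//; by rewrite (le_lt_trans NP)// ltr_nat ltnS.
have [M MP] := Banach_Steinhauss F_lin F_ptwise 1.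
have [n Mn] : exists n : nat, M <= n%:R.
  by exists (Num.truncn M).+1; exact/ltW/truncnS_gt.
have wn0 : 0 < `|w n|.
  rewrite normr_gt0; apply/eqP => w0; have := swn n.
  by rewrite w0 -(scale0r (0 : V)) T_lin !scale0r normr0 mulr0 ltxx.
have := MP (T (s n)) (ex_intro2 _ _ n I erefl) (`|w n|^-1 *: w n).
rewrite T_lin !normrZ normfV normr_id mulVf ?gt_eqF// lexx => /(_ isT).
apply/negP; rewrite -ltNge (le_lt_trans Mn)// mulrC ltr_pdivlMr//.
Qed.
End LocalBoundedness.

(** * Bernstein polynomials *)

Section Bernstein.
Variable R : realType.
Implicit Types (f h : nat -> R) (n : nat) (c : R).

(** The Bernstein polynomial of degree n with coefficients f 0, ..., f n, i.e.
    the mean of f under the binomial law of parameters n and x, defined by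
    conditioning on the first trial; this makes linearity, monotonicity and the
    variance immediate by induction. *)
Fixpoint bernstein n f : {poly R} :=
  if n is n'.+1 then
    'X * bernstein n' (fun k => f k.+1) + (1 - 'X) * bernstein n' f
  else (f 0%N)%:P.

Lemma bernsteinS n f (x : R) : (bernstein n.+1 f).[x] =
  x * (bernstein n (fun k => f k.+1)).[x] + (1 - x) * (bernstein n f).[x].
Proof. by rewrite /= !hornerE. Qed.

Lemma bernstein_linear n (a : R) f h (x : R) :
  (bernstein n (fun k => a * f k + h k)).[x] =
  a * (bernstein n f).[x] + (bernstein n h).[x].
Proof.
elim: n f h => [|n IH] f h; first by rewrite /= !hornerC.
by rewrite !bernsteinS !IH; ring.
Qed.

Lemma bernstein_const n c (x : R) : (bernstein n (fun=> c)).[x] = c.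
Proof.
elim: n => [|n IH]; first by rewrite /= hornerC.
by rewrite bernsteinS IH; ring.
Qed.

Lemma bernstein_le n f h (x : R) : 0 <= x <= 1 ->
  (forall k, (k <= n)%N -> f k <= h k) ->
  (bernstein n f).[x] <= (bernstein n h).[x].
Proof.
move=> /andP[x0 x1]; elim: n f h => [|n IH] f h fh.
  by rewrite /= !hornerC fh.
rewrite !bernsteinS lerD// ler_wpM2l ?subr_ge0// IH// => k kn; apply: fh => //.
exact: leqW.
Qed.

(** An arbitrary centre c keeps the induction going: shifting the argument of f
    turns c into c - 1. *)
Lemma bernstein_variance n c (x : R) :
  (bernstein n (fun k => (k%:R - c) ^+ 2)).[x] =
  (n%:R * x - c) ^+ 2 + n%:R * (x * (1 - x)).
Proof.
elim: n c => [|n IH] c; first by rewrite /= hornerC; ring.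
rewrite bernsteinS IH.
have -> : (fun k : nat => (k.+1%:R - c) ^+ 2) = fun k => (k%:R - (c - 1)) ^+ 2.
  by apply/funext => k; rewrite -natr1; ring.
by rewrite IH -natr1; ring.
Qed.

Lemma uniform_modulus (g : unitI R -> R) (e : R) : continuous g -> 0 < e ->
  exists2 d : R, 0 < d &
    forall x y : unitI R, `|pt y - pt x| < d -> `|g y - g x| <= e.
Proof.
move=> cg e0; pose f t := g (clampI t).
have cf : continuous f.
  by move=> t; apply: continuous_comp; [exact: clampI_continuous|exact: cg].
pose P d t := forall s, `|s - t| < d -> `|f s - f t| <= e.
have : \forall d \near 0^'+, `[0, 1]%classic `<=` P d.
  have /compact_near_coveringP := @segment_compact R 0 1; apply => t _.
  have e2 : 0 < e / 2 by rewrite divr_gt0.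
  have /cvgrPdist_le /(_ _ e2) /nbhs_ballP[d /= d0 dP] := cf t.
  have d2 : 0 < d / 2 by rewrite divr_gt0.
  exists (ball t (d / 2), [set d' | d' < d / 2]).
    by split; [exact: nbhsx_ballx|exact: nbhs_right_lt].
  move=> [t' d'] [/= tt' d'd] s st'.
  rewrite /ball/= in tt'.
  have : `|f t - f t'| <= e / 2 by apply: dP; rewrite /ball/=; lra.
  have : `|f t - f s| <= e / 2.
    apply: dP; rewrite /ball/=; have := ler_distD t' t s.
    by rewrite (distrC t' s); lra.
  have := ler_distD (f t) (f s) (f t'); rewrite (distrC (f s) (f t)).
  by have := splitr e; lra.
move=> near0.
have [d [dP d0]] := filter_ex (filterI near0 (nbhs_right_gt (0 : R))).
exists d => // x y xy.
have := dP (pt x) _ (pt y) xy; rewrite /f !clampIK; apply.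
by rewrite /= in_itv /= pt_ge0 pt_le1.
Qed.

(** With y = k / n, the difference g y - g x is at most e / 2 for y close to x,
    and otherwise at most a multiple of (y - x)^2, whose mean is O(1 / n). *)
Lemma weierstrass (g : unitI R -> R) (e : R) : continuous g -> 0 < e ->
  exists p : {poly R}, forall x : unitI R, `|p.[pt x] - g x| <= e.
Proof.
move=> cg e0; have e2 : 0 < e / 2 by rewrite divr_gt0.
have [d d0 gd] := uniform_modulus cg e2.
have [M M0 gM] : exists2 M : R, 0 <= M & forall x : unitI R, `|g x| <= M.
  have cN : continuous (fun x => - `|g x|).
    move=> x; apply: (@cvgN _ _ _ (nbhs x)).
    by apply: (@cvg_norm _ _ _ (nbhs x)); exact: cg.
  have [a aP] := EVT_min_unitI cN.
  by exists `|g a| => // x; rewrite -lerN2.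
pose K := 2 * M / d ^+ 2.
have K0 : 0 <= K by rewrite divr_ge0 ?mulr_ge0 // ltW.
near \oo => n.
have n0 : 0 < n%:R :> R by rewrite ltr0n; near: n; exact: nbhs_infty_gt.
have Kn : K / (e / 2) <= n%:R by near: n; exact: nbhs_infty_ger.
pose q := bernstein n (fun k => g (clampI (k%:R / n%:R))).
exists q => x; have x01 : 0 <= pt x <= 1 by rewrite pt_ge0 pt_le1.
pose E k := K / n%:R ^+ 2 * (k%:R - n%:R * pt x) ^+ 2 + e / 2.
have key k : (k <= n)%N -> `|g (clampI (k%:R / n%:R)) - g x| <= E k.
  move=> kn; have y01 : 0 <= (k%:R / n%:R : R) <= 1.
    by rewrite divr_ge0//= ler_pdivrMr// mul1r ler_nat.
  have S0 : 0 <= K / n%:R ^+ 2 * (k%:R - n%:R * pt x) ^+ 2.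
    by rewrite mulr_ge0 ?sqr_ge0// divr_ge0// exprn_ge0// ltW.
  have [near_x|far_x] := ltP `|k%:R / n%:R - pt x| d.
    have := gd x (clampI (k%:R / n%:R)); rewrite pt_clampI// => /(_ near_x).
    by rewrite /E; lra.
  have -> : E k = K * (k%:R / n%:R - pt x) ^+ 2 + e / 2.
    by rewrite /E; congr (_ + _); field; rewrite gt_eqF.
  have : K * d ^+ 2 <= K * (k%:R / n%:R - pt x) ^+ 2.
    by rewrite ler_wpM2l// -[leRHS]real_normK ?num_real// lerXn2r// nnegrE ltW.
  rewrite /K divfK ?expf_neq0 ?gt_eqF//.
  have := ler_normB (g (clampI (k%:R / n%:R))) (g x).
  by have := gM x; have := gM (clampI (k%:R / n%:R)); lra.
have BE : (bernstein n E).[pt x] <= e.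
  rewrite bernstein_linear bernstein_variance bernstein_const subrr expr0n add0r.
  have -> : K / n%:R ^+ 2 * (n%:R * (pt x * (1 - pt x))) =
      K / n%:R * (pt x * (1 - pt x)).
    by field; rewrite gt_eqF.
  have : K / n%:R <= e / 2.
    by rewrite ler_pdivrMr// mulrC -ler_pdivrMr.
  have : K / n%:R * (pt x * (1 - pt x)) <= K / n%:R.
    by rewrite ler_piMr ?divr_ge0 ?(ltW n0)//; have /andP[? ?] := x01; nra.
  by have := splitr e; lra.
(* The factors 1 and -1 give the summands the form required by linearity. *)
have qE : q.[pt x] - g x =
    (bernstein n (fun k => 1 * g (clampI (k%:R / n%:R)) + - g x)).[pt x].
  by rewrite bernstein_linear bernstein_const mul1r.
have qNE : g x - q.[pt x] =
    (bernstein n (fun k => -1 * g (clampI (k%:R / n%:R)) + g x)).[pt x].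
  by rewrite bernstein_linear bernstein_const mulN1r addrC.
rewrite qE ler_norml; apply/andP; split.
  rewrite lerNl -qE opprB qNE; apply: le_trans BE; apply: bernstein_le => // k kn.
  rewrite mulN1r addrC (le_trans (ler_norm _))// distrC; exact: key.
apply: le_trans BE; apply: bernstein_le => // k kn; rewrite mul1r.
exact: le_trans (ler_norm _) (key k kn).
Unshelve. all: by end_near. Qed.
End Bernstein.

(** * Density of the domain *)

Section Density.
Variables (R : realType) (m : nat) (sigma : 'rV[R]_m).
Variables (K00 K01 K10 K11 : 'M[R]_m).

(** Approximate u by polynomials, then repair the boundary conditions: the
    slopes to be corrected are fixed while the size of the bumps is O(1 / n). *)
Lemma domain_dense (u : CI R m) (e : R) : 0 < e ->
  exists v f, A_Phi sigma K00 K01 K10 K11 v f /\ `|v - u| <= e.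
Proof.
move=> e0; have e2 : 0 < e / 2 by rewrite divr_gt0.
have /choice[p pP] i := weierstrass (@CI_coord_continuous R m u i) e2.
pose p0 := \col_j (p j).[0]; pose p1 := \col_j (p j).[1].
pose c i := (K00 *m p0 + K01 *m p1) i 0 - (p i)^`().[0].
pose d i := (K10 *m p0 + K11 *m p1) i 0 - (p i)^`().[1].
near \oo => n.
have n0 : (0 < n)%N by near: n; exact: nbhs_infty_gt.
have nk i : (`|c i| + `|d i|) / (e / 2) <= n%:R.
  by move: i; near: n; apply: filter_forall => i; exact: nbhs_infty_ger.
exists (polyCI (boundary_correction K00 K01 K10 K11 p n)); eexists; split.
  exact: boundary_correction_in_domain.
apply: CI_norm_le => [|x i]; first exact: ltW.
have x01 : 0 <= pt x <= 1 by rewrite pt_ge0 pt_le1.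
have one : (1 : {poly R}).[pt x] = 1 by rewrite -polyC1 hornerC.
rewrite !mxE /= /boundary_correction -/(c i) -/(d i).
rewrite !(horner_exp, hornerD, hornerN, hornerZ, hornerM, hornerX, hornerC, one).
have := nk i; rewrite ler_pdivrMr// mulrC => cd.
have := bumps_le x01 cd n0; have := pP i x.
rewrite !ler_norml => /andP[? ?] /andP[? ?].
by apply/andP; split; have := splitr e; lra.
Unshelve. all: by end_near. Qed.
End Density.

(** * Sufficiency of the sign conditions *)

Section Sufficiency.
Variables (R : realType) (m : nat) (sigma : 'rV[R]_m).
Variables (K00 K01 K10 K11 : 'M[R]_m).
Hypothesis sigma_gt0 : forall i, 0 < sigma 0 i.
Hypothesis off_diag : forall i j, i != j -> K00 i j <= 0 /\ 0 <= K11 i j.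
Hypothesis coupling : forall i j, K01 i j <= 0 /\ 0 <= K10 i j.
Variable T : R -> CI R m -> CI R m.
Hypothesis genT : generates (A_Phi sigma K00 K01 K10 K11) T.

Lemma aboveD_norm (phi : {poly R}) c e (u v : CI R m) :
  (forall x : unitI R, 1 <= phi.[pt x]) ->
  above phi c u -> `|v| <= e -> above phi (c + e) (u + v).
Proof.
move=> phi1 uc ve x i; have := uc x i; have := coord_le_norm v x i.
have e0 : 0 <= e by exact: le_trans (normr_ge0 v) ve.
have := ler_wpM2l e0 (phi1 x).
rewrite ler_norml !mxE => H1 /andP[H2 _] H3; lra.
Qed.

Lemma bernoulli_sub (y : R) n : 0 <= y <= 1 -> 1 - n%:R * y <= (1 - y) ^+ n.
Proof.
move=> /andP[y0 y1]; elim: n => [|n IH]; first by rewrite mul0r subr0 expr0.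
rewrite exprSr; have y1' : 0 <= 1 - y by rewrite subr_ge0.
apply: le_trans (ler_wpM2r y1' IH).
have : 0 <= n%:R * y * y by rewrite !mulr_ge0.
by rewrite -natr1; lra.
Qed.

(** Each of the n implicit Euler steps of size h = t / n divides the bound by
    1 - h mu and adds M h e, the size of the defect carried along the orbit.
    Since (1 - h mu)^n >= 1 - t mu >= 1 / 2, the final bound is at most
    2 (c + M t e), and e is arbitrary. *)
Lemma orbit_lower_bound phi mu M u f t c :
  barrier sigma K00 K01 K10 K11 phi mu -> 0 <= mu -> 0 <= M ->
  (forall s v, 0 <= s <= t -> `|T s v| <= M * `|v|) ->
  0 < t -> t * mu <= 2^-1 -> A_Phi sigma K00 K01 K10 K11 u f ->
  0 <= c -> above phi c u -> above phi (2 * c) (T t u).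
Proof.
move=> bar mu0 M0 TM t0 tmu uf c0 uc x i.
have [C0T A_gen] := genT; have [phi1 _ _ _] := bar.
have genuf : generator T u f by apply/A_gen.
have [_ T0 TD _] := C0T.
suff H e : 0 < e -> - ((2 * (c + M * t * e)) * phi.[pt x]) <= T t u x i 0.
  apply/ler_addgt0Pr => e e0.
  pose e' := e / (2 * (M * t + 1) * phi.[pt x]).
  have phix0 : 0 < phi.[pt x] by exact: lt_le_trans (phi1 x).
  have Mt0 : 0 <= M * t by rewrite mulr_ge0// ltW.
  have den0 : 0 < 2 * (M * t + 1) * phi.[pt x] by rewrite !mulr_gt0// ltr_wpDl.
  have e'0 : 0 < e' by rewrite divr_gt0.
  have := H e' e'0.
  have -> : e = e' * (2 * (M * t + 1) * phi.[pt x]) by rewrite divfK// gt_eqF.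
  have := mulr_ge0 (ltW e'0) (ltW phix0).
  lra.
(* With n depending on e, run the n Euler steps. *)
move=> e0; have [n n0 defect] := euler_defect_small C0T genuf t0 e0.
set h := t / n%:R in defect.
have n0' : 0 < n%:R :> R by rewrite ltr0n.
have h0 : 0 < h by rewrite divr_gt0.
have nh : n%:R * h = t by rewrite mulrC divfK// gt_eqF.
have nhmu : n%:R * (h * mu) <= 2^-1 by rewrite mulrA nh.
have hmu0 : 0 <= h * mu by rewrite mulr_ge0// ltW.
have hmu : h * mu <= 2^-1.
  by apply: le_trans nhmu; rewrite ler_peMl// ler1n.
have D0 : 0 < 1 - h * mu by lra.
have D1 : 1 - h * mu <= 1 by lra.
have step k : (k <= n)%N ->
    above phi ((c + k%:R * (M * h * e)) / (1 - h * mu) ^+ k) (T (k%:R * h) u).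
  elim: k => [_|k IH kn]; first by rewrite !mul0r T0 expr0 divr1 addr0.
  have kh0 : 0 <= k%:R * h by rewrite mulr_ge0// ltW.
  have Skh0 : 0 <= k.+1%:R * h by rewrite mulr_ge0// ltW.
  have [TZk TDk TBk] := semigroup_linear C0T kh0.
  have uf' : A_Phi sigma K00 K01 K10 K11
      (T (k.+1%:R * h) u) (T (k.+1%:R * h) f).
    by apply/A_gen; exact: generator_orbit.
  have Mhe0 : 0 <= M * h * e by rewrite !mulr_ge0// ltW.
  pose ck := (c + k%:R * (M * h * e)) / (1 - h * mu) ^+ k.
  have Dk0 : 0 < (1 - h * mu) ^+ k by exact: exprn_gt0.
  have ck0 : 0 <= ck.
    exact: divr_ge0 (addr_ge0 c0 (mulr_ge0 (ler0n R k) Mhe0)) (ltW Dk0).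
  have step_error : above phi (ck + M * h * e)
      (T (k.+1%:R * h) u - h *: T (k.+1%:R * h) f).
    have -> : T (k.+1%:R * h) u - h *: T (k.+1%:R * h) f = T (k%:R * h) u
        + T (k%:R * h) (h *: (h^-1 *: (T h u - u) - T h f)).
      rewrite scalerBr scalerA mulfV ?gt_eqF// scale1r !TBk TZk.
      rewrite -!TD ?(ltW h0)//.
      by rewrite -natr1 mulrDl mul1r addrA addrCA subrr addr0.
    apply: aboveD_norm => //; first exact: (IH (ltnW kn)).
    apply: le_trans (TM _ _ _) _.
      by rewrite kh0 /= -nh ler_pM2r// ler_nat ltnW.
    by rewrite -mulrA ler_wpM2l// normrZ gtr0_norm// ler_pM2l.
  have hmu1 : h * mu < 1 by lra.
  have := resolvent_lower_bound sigma_gt0 off_diag coupling bar mu0 uf'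
    (ltW h0) hmu1 (addr_ge0 ck0 Mhe0) step_error.
  move=> H y j; apply: le_trans (H y j); rewrite lerN2 ler_wpM2r//.
    exact: le_trans (phi1 y).
  have -> : (c + k.+1%:R * (M * h * e)) / (1 - h * mu) ^+ k.+1 =
      (ck + (M * h * e) / (1 - h * mu) ^+ k) / (1 - h * mu).
    by rewrite /ck exprSr invfM -natr1; ring.
  rewrite ler_pM2r ?invr_gt0// lerD2l ler_peMr//.
  by rewrite invf_ge1// exprn_ile1// ltW.
have := step n (leqnn n) x i; rewrite nh.
apply: le_trans; rewrite lerN2 ler_wpM2r//; first exact: le_trans (phi1 x).
have -> : n%:R * (M * h * e) = M * t * e by rewrite -nh; ring.
rewrite mulrC ler_wpM2r//.
  by rewrite addr_ge0// !mulr_ge0// ltW.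
have D01 : 0 <= h * mu <= 1 by lra.
rewrite invf_ple ?posrE ?exprn_gt0//.
apply: le_trans (bernoulli_sub n D01); lra.
Qed.

(** The lower bound on orbits holds for times up to some positive length; longer
    times are cut into pieces of at most this length. *)
Lemma signs_positive : positive_semigroup T.
Proof.
have [C0T A_gen] := genT.
have [M [d [M0 d0 TM]]] := C0_semigroup_locally_bounded C0T.
have [phi [mu [bar mu0 [C C0 phiC]]]] :=
  barrier_exists K00 K01 K10 K11 sigma_gt0.
have [phi1 _ _ _] := bar.
have small t u : 0 < t -> t <= d -> t * mu <= 2^-1 -> nonneg_fun u ->
    nonneg_fun (T t u).
  move=> t0 td tmu u0 x i; apply/ler_addgt0Pr => e e0.
  pose e' := e / (2 * C + M).
  have den0 : 0 < 2 * C + M by rewrite ltr_pwDl// mulr_gt0.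
  have e'0 : 0 < e' by rewrite divr_gt0.
  have [v [f [vf vu]]] := domain_dense sigma K00 K01 K10 K11 u e'0.
  have ve : above phi e' v.
    move=> y j; have := coord_le_norm (v - u) y j.
    rewrite !mxE ler_norml => /andP[H _].
    have := ler_wpM2l (ltW e'0) (phi1 y); have := u0 y j; lra.
  have TM' s w : 0 <= s <= t -> `|T s w| <= M * `|w|.
    by move=> /andP[s0 st]; apply: TM; rewrite s0 (le_trans st).
  have := orbit_lower_bound bar mu0 M0 TM' t0 tmu vf (ltW e'0) ve x i.
  have [_ _ TB] := semigroup_linear C0T (ltW t0).
  have := coord_le_norm (T t v - T t u) x i; rewrite -TB.
  have : `|T t (v - u)| <= M * e'.
    by apply: le_trans (TM' _ _ _) _; [rewrite lexx ltW|rewrite ler_wpM2l].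
  have := ler_wpM2l (ltW e'0) (phiC x).
  rewrite TB !mxE ler_norml => H1 H2 /andP[H3 H4] H5.
  have -> : e = e' * (2 * C + M) by rewrite divfK// gt_eqF.
  lra.
move=> t; rewrite le_eqVlt => /predU1P[<- u u0|t0 u u0].
  by have [_ -> _ _] := C0T.
near \oo => n.
have n0 : 0 < n%:R :> R by rewrite ltr0n; near: n; exact: nbhs_infty_gt.
have nd : t / d <= n%:R by near: n; exact: nbhs_infty_ger.
have nmu : t * mu / 2^-1 <= n%:R by near: n; exact: nbhs_infty_ger.
pose h := t / n%:R.
have h0 : 0 < h by rewrite divr_gt0.
have hd : h <= d by rewrite ler_pdivrMr// mulrC -ler_pdivrMr.
have hmu : h * mu <= 2^-1.
  by rewrite /h mulrAC ler_pdivrMr// [leRHS]mulrC -ler_pdivrMr// invr_gt0.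
have -> : t = n%:R * h by rewrite mulrC divfK// gt_eqF.
move: h h0 hd hmu => h h0 hd hmu; elim: (n) => [|k IH].
  by rewrite mul0r; have [_ -> _ _] := C0T.
have [_ _ TD _] := C0T.
rewrite -natr1 mulrDl mul1r addrC TD ?(ltW h0)// ?mulr_ge0// ?(ltW h0)//.
exact: small.
Unshelve. all: by end_near. Qed.
End Sufficiency.

Theorem theorem2p5 (R : realType) (m : nat) (sigma : 'rV[R]_m)
    (sigma_gt0 : forall i, 0 < sigma 0 i) (K00 K01 K10 K11 : 'M[R]_m)
    (T : R -> CI R m -> CI R m)
    (genT : generates (A_Phi sigma K00 K01 K10 K11) T) :
  positive_semigroup T <->
  (forall i j, i != j -> 0 <= (- K00) i j /\ 0 <= K11 i j) /\
  (forall i j, 0 <= (- K01) i j /\ 0 <= K10 i j).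
Proof.
have signE (K : 'M[R]_m) i j : (0 <= (- K) i j) = (K i j <= 0).
  by rewrite mxE oppr_ge0.
split=> [posT|[off_diag coupling]].
  have [off_diag coupling] := positive_signs sigma_gt0 genT posT.
  by split=> [i j ij|i j]; rewrite signE; [exact: off_diag|exact: coupling].
apply: (signs_positive sigma_gt0 _ _ genT) => [i j ij|i j]; rewrite -signE.
  exact: off_diag.
exact: coupling.
Qed.
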